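(* Let $n$ be odd, $q=e^{2\pi i/n}$, and let $\varphi=\varphi_1\circ\cdots\circ\varphi_{k_0}\circ\psi_1^{\epsilon_1}\psi_2^{\epsilon_2}$ be a pseudo-Anosov diffeomorphism of the four-puncture sphere, where each $\varphi_k$ is $L$ or $R$ and $\varphi_1=L$. Let $u_k,\hat u_k,v_k,\hat v_k$ ($1\le k\le k_0$) and the integers $\hat l_1,\hat l_2$ be the data described in the context, and let $\Lambda^q_{\varphi,\tilde r}=\Lambda_1\circ\cdots\circ\Lambda_{k_0}\circ T$ be the associated intertwiner. Put $\varepsilon_k=1$ if $\varphi_k=R$, $\varepsilon_k=-1$ if $\varphi_k=L$, and $\varepsilon_{k_0+1}=\varepsilon_1$, $i_{k_0+1}=i_1$. Then $$\mathrm{Trace}(\Lambda^q_{\varphi,\tilde r})=A_n\sum_{i_1,\dots,i_{k_0}=1}^n \exp\left(\frac{2\pi \sqrt{-1}}{n}\Big(-i_{k_0}\hat l_2-i_1\hat l_1+\sum_{k=1}^{k_0}\big(i_{k+1}^2+\tfrac{\varepsilon_{k+1}}2(i_k^2+i_{k+1}^2-4i_ki_{k+1})\big)\Big)\right)\prod_{k=1}^{k_0}QDL^q(u_k,v_k|i_k)\,QDL^q(\hat u_k,\hat v_k|i_k),$$ where $$A_n=\frac{q^{\,\hat l_1\hat l_2/2-\hat l_1/4}}{n^{k_0/2}\prod_{k=1}^{k_0}D^q(u_k)^{1/n}D^q(\hat u_k)^{1/n}}.$$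
   Context: Discrete quantum dilogarithm: for $u,v\in\mathbb C$ with $v^n=1+u^n\ne0$, $QDL^q(u,v|j)=v^{-j}\prod_{k=1}^j(1+uq^{-2k})$ (it is $n$-periodic in $j$), and $D^q(u)=\prod_{j=1}^nQDL^q(u,v|j)$; $D^q(u)^{1/n}$ is a fixed choice of $n$-th root. Powers of $q$ mean $q^s=e^{2\pi\sqrt{-1}s/n}$. In a word $\varphi=L^{n_1}R^{m_1}\cdots L^{n_k}R^{m_k}\psi_1^{\epsilon_1}\psi_2^{\epsilon_2}$ ($k\geq 1$, $n_i,m_i>0$, $\epsilon_i\in\{0,1\}$), $L=\begin{pmatrix}1&1\\0&1\end{pmatrix}$ and $R=\begin{pmatrix}1&0\\1&1\end{pmatrix}$ generate the $\mathrm{PSL}_2(\mathbb Z)$ factor and $\psi_1,\psi_2$ the $\mathbb Z_2\times\mathbb Z_2$ factor of the mapping class group $\mathrm{PSL}_2(\mathbb Z)\ltimes(\mathbb Z_2\times\mathbb Z_2)$ of the four-puncture sphere; $k_0=\sum(n_i+m_i)$. Data. One has parameters $x_k,y_k\in\mathbb C^*$, $\mathbf p^{(k)}=(p_1^{(k)},\dots,p_4^{(k)})\in(\mathbb C^* )^4$ ($0\le k\le k_0$) and $h\in\mathbb C^*$ with $h^2=p_1^{(k)}p_2^{(k)}p_3^{(k)}p_4^{(k)}$, satisfying (writing $p_j=p_j^{(k-1)}$): if $\varphi_k=L$: $u_k=qy_{k-1}$, $\hat u_k=qh p_1^{-1}p_2^{-1}y_{k-1}$, $v_k^n=1+u_k^n\neq0$,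 $\hat v_k^n=1+\hat u_k^n\ne0$, $x_k=y_{k-1}^{-1}$, $y_k=v_k\hat v_kp_2p_4h^{-1}x_{k-1}$, $\mathbf p^{(k)}=(p_4,p_2,p_3,p_1)$; if $\varphi_k=R$: $u_k=qp_1x_{k-1}^{-1}y_{k-1}^{-1}$, $\hat u_k=qhp_4^{-1}x_{k-1}^{-1}y_{k-1}^{-1}$, $v_k^n=1+u_k^n\ne0$, $\hat v_k^n=1+\hat u_k^n\ne0$, $x_k=p_1^{-1}x_{k-1}y_{k-1}$, $y_k=v_k\hat v_ky_{k-1}$, $\mathbf p^{(k)}=(p_2,p_1,p_3,p_4)$. Logarithms $A_k,B_k\in\mathbb C$ are fixed with $x_k=e^{A_k/n}$, $y_k=e^{B_k/n}$. The shear-bend parameters $a_k=x_k^n$, $b_k=y_k^n$ are periodic, $(a_{k_0},b_{k_0})=(a_0,b_0)$, and $\mathbf p^{(k_0)}=\mathbf p^{(0)}$ (the edge re-indexing given by $\psi_1^{\epsilon_1}\psi_2^{\epsilon_2}$, whose intertwiner is trivial, being omitted). The integers $\hat l_1,\hat l_2$ are defined by $A_0=A_{k_0}+2\pi\sqrt{-1}\,\hat l_1$, $B_0=B_{k_0}+2\pi\sqrt{-1}\,\hat l_2$. With $l_j=\hat l_j(n-1)^2/2$ one has $x_0=q^{2l_1}x_{k_0}$, $y_0=q^{2l_2}y_{k_0}$. Matrices on $\mathbb C^n$ (indices modulo $n$, $\Lambda w_j=\sum_i\Lambda_{i,j}w_i$): $(\Lambda_k)_{i,j}=\dfrac{q^{(2j^2+i-j+\varepsilon_k(i^2+j^2-4ij))/2}\,QDL^q(u_k,v_k|j)\,QDL^q(\hat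 u_k,\hat v_k|j)}{\sqrt n\,D^q(u_k)^{1/n}D^q(\hat u_k)^{1/n}}$ and $T_{i,j}=q^{-2jl_2-jl_1}\delta_{i,j+l_1}$. The $\Lambda_k$ are the intertwiners between the standard representations of the Chekhov–Fock algebra of $S_{0,4}$ along the diagonal exchanges $\varphi_k$, and $T$ is the twist intertwiner closing up the mapping torus.
   Formalization: The power of q in A_n is corrected from q^{l̂_1l̂_2/2−l̂_1/4} to q^{2l_1l_2−l_1/2+l_1^2/2}, where l_j=l̂_j(n−1)^2/2, because the printed equality fails (e.g. n=1, φ=LR, l̂_1=1, l̂_2=0). *)

(* Defs.v *)
(* The complex numbers are R[i] for R : realType. *)
From HB Require Import structures.
From mathcomp Require Import all_boot all_order all_algebra.
From mathcomp Require Import complex.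
From mathcomp Require Import reals sequences exp trigo.

Set Implicit Arguments.
Unset Strict Implicit.
Unset Printing Implicit Defensive.

Import Order.TTheory GRing.Theory Num.Theory.
Local Open Scope ring_scope.

Inductive letter := letL | letR.

Definition letter_sign (l : letter) : int :=
  match l with letL => -1 | letR => 1 end.

(* L^{n_1} R^{m_1} ... L^{n_k} R^{m_k} psi_1^{e_1} psi_2^{e_2} with k >= 1 and
   all n_i, m_i > 0, the pairs (n_i, m_i) being the blocks.  Such an element of
   PSL_2(Z) |>< (Z_2 x Z_2) is automatically pseudo-Anosov: its first component
   is a product of positive powers of both L and R, hence hyperbolic. *)
Record pA_word := PAWord {
  blocks : seq (nat * nat);
  psi1 : bool;
  psi2 : bool;
  blocks_neq0 : blocks != [::];
  blocks_gt0 : all (fun b => (0 < b.1)%N && (0 < b.2)%N) blocks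
}.

Definition letters (phi : pA_word) : seq letter :=
  flatten [seq nseq b.1 letL ++ nseq b.2 letR | b <- blocks phi].

(* The k-th entry of s for 1-based cyclic indexing: k = 1 is the first entry,
   and k = size s + 1 is the first entry again. *)
Definition cnth (T : Type) (x0 : T) (s : seq T) (k : nat) : T :=
  nth x0 s (k.-1 %% size s).

Section Complex.
Variable R : realType.
Local Notation C := R[i].

Definition expC (z : C) : C :=
  (expR (complex.Re z))%:C%C * (cos (complex.Im z) +i* sin (complex.Im z))%C.

Definition two_pi_i : C := (0 +i* (2 * pi))%C.

(* q^s = e^{2 pi i s / n}, also for fractional s *)
Definition qpow (n : nat) (s : C) : C := expC (two_pi_i * s / n%:R).

Definition QDL (n : nat) (u v : C) (j : nat) : C :=
  v ^- j * \prod_(1 <= k < j.+1) (1 + u * qpow n (- (2 * k%:R))).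

Definition Dq (n : nat) (u v : C) : C :=
  \prod_(1 <= j < n.+1) QDL n u v j.

(* Row and column indices i, j : 'I_n stand for the basis vectors w_{i+1},
   w_{j+1}, so that the paper's 1-based indices are i.+1 and j.+1.
   d, dh are the chosen n-th roots of D^q(u), D^q(uh). *)
Definition Lambda (n : nat) (e : int) (u uh v vh d dh : C) : 'M[C]_n :=
  \matrix_(i < n, j < n)
    let I : C := i.+1%:R in
    let J : C := j.+1%:R in
    qpow n ((2 * J ^+ 2 + I - J
             + e%:~R * (I ^+ 2 + J ^+ 2 - 4 * I * J)) / 2)
    * QDL n u v j.+1 * QDL n uh vh j.+1
    / (sqrtC n%:R * d * dh).

Definition Twist (n : nat) (l1 l2 : int) : 'M[C]_n :=
  \matrix_(i < n, j < n)
    if (i.+1%:Z == j.+1%:Z + l1 %[mod n])%Z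
    then qpow n (- (2 * j.+1%:R * l2%:~R) - j.+1%:R * l1%:~R)
    else 0.

Record edge_weights := EdgeWeights {
  wx : C; wy : C; wp1 : C; wp2 : C; wp3 : C; wp4 : C
}.

Definition admissible (h : C) (s : edge_weights) : Prop :=
  [/\ wx s != 0, wy s != 0,
      [&& wp1 s != 0, wp2 s != 0, wp3 s != 0 & wp4 s != 0]
    & h ^+ 2 = wp1 s * wp2 s * wp3 s * wp4 s].

(* The diagonal exchange l takes the edge weights s to s'. *)
Definition flip (n : nat) (l : letter) (h : C) (s s' : edge_weights)
    (u uh v vh : C) : Prop :=
  let q := qpow n 1 in
  let: EdgeWeights x y p1 p2 p3 p4 := s in
  [/\ v ^+ n = 1 + u ^+ n, 1 + u ^+ n != 0,
      vh ^+ n = 1 + uh ^+ n, 1 + uh ^+ n != 0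
    & match l with
      | letL =>
          [/\ u = q * y, uh = q * h * p1^-1 * p2^-1 * y
            & s' = EdgeWeights y^-1 (v * vh * p2 * p4 * h^-1 * x) p4 p2 p3 p1]
      | letR =>
          [/\ u = q * p1 * x^-1 * y^-1, uh = q * h * p4^-1 * x^-1 * y^-1
            & s' = EdgeWeights (p1^-1 * x * y) (v * vh * y) p2 p1 p3 p4]
      end].

(* s k is the set of weights after the first k exchanges of the word w; the
   k-th exchange (1 <= k <= size w) has parameters u k, uh k, v k, vh k.
   Values of the sequences outside these ranges are irrelevant. *)
Record periodic_flips (n : nat) (w : seq letter) (h : C)
    (s : nat -> edge_weights) (u uh v vh : nat -> C) : Prop := PeriodicFlips {
  pf_h : h != 0;
  pf_admissible : forall k, (k <= size w)%N -> admissible h (s k);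
  pf_flip : forall k, (1 <= k <= size w)%N ->
    flip n (cnth letL w k) h (s k.-1) (s k) (u k) (uh k) (v k) (vh k);
  pf_a : wx (s (size w)) ^+ n = wx (s 0%N) ^+ n;
  pf_b : wy (s (size w)) ^+ n = wy (s 0%N) ^+ n;
  pf_p : [/\ wp1 (s (size w)) = wp1 (s 0%N), wp2 (s (size w)) = wp2 (s 0%N),
             wp3 (s (size w)) = wp3 (s 0%N) & wp4 (s (size w)) = wp4 (s 0%N)]
}.

End Complex.

(* For n odd the division by 2 is exact and (n-1)^2/2 is an inverse of 2
   modulo n, so that q^{2l} = q^{lhat}. *)
Definition twist_shift (n : nat) (lhat : int) : int :=
  lhat * ((n.-1 ^ 2) %/ 2)%N%:Z.

(* Main.v *)
(* Expanding the trace of Lambda_1 ... Lambda_{k0} T over closed index paths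
   i_0, i_1, ..., i_{k0}, the twist forces i_0 = i_{k0} - l1 mod n.  As n is odd,
   the exponents of q are n-periodic in the indices although they involve
   halves, so i_0 can be replaced by i_{k0} - l1; expanding the square and using
   q^{2 l_j} = q^{lhat_j} gives the twist terms and the prefactor. *)
Require Import Defs.
From HB Require Import structures.
From mathcomp Require Import all_boot all_order all_algebra.
From mathcomp Require Import complex.
From mathcomp Require Import reals sequences exp trigo.
From mathcomp Require Import zify ring.

Set Implicit Arguments.
Unset Strict Implicit.
Unset Printing Implicit Defensive.

Import Order.TTheory GRing.Theory Num.Theory.
Local Open Scope ring_scope.

(** * Cyclic indexing of finite sequences *)

Section CyclicTuples.
Variables (T : Type).

Lemma cnth_nth (x0 : T) (s : seq T) k :
  (k < size s)%N -> cnth x0 s k.+1 = nth x0 s k.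
Proof. by move=> lt_ks; rewrite /cnth /= modn_small. Qed.

Lemma cnth_size (x0 : T) (s : seq T) :
  cnth x0 s (size s).+1 = nth x0 s 0.
Proof. by rewrite /cnth /= modnn. Qed.

End CyclicTuples.

(** * Matrix products and traces as sums over index paths *)

Section MatrixProducts.
Variables (K : comPzRingType) (n : nat).

Lemma big_tupleS (T : finType) m (F : m.+1.-tuple T -> K) :
  \sum_(t : m.+1.-tuple T) F t =
  \sum_(a : T) \sum_(t : m.-tuple T) F [tuple of a :: t].
Proof.
rewrite pair_big (reindex (fun p : T * m.-tuple T => [tuple of p.1 :: p.2])) //=.
exists (fun t => (thead t, [tuple of behead t])) => [[a t]|t] _ /=.
  by congr pair; apply: val_inj.
by rewrite -tuple_eta.
Qed.

Lemma big_mulmxE m a (M : nat -> 'M[K]_n) i j :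
  (\big[mulmx/1%:M]_(a <= k < a + m) M k) i j =
  \sum_(t : m.-tuple 'I_n | last i t == j)
    \prod_(k < m) M (a + k)%N (nth i (i :: t) k) (nth i t k).
Proof.
elim: m a i => [|m IHm] a i.
  rewrite addn0 big_geq // mxE
    (eq_bigl (fun t : 0.-tuple 'I_n => i == j)); last first.
    by move=> t; rewrite tuple0.
  case: eqP => _; last by rewrite big_pred0.
  by rewrite (big_pred1 [tuple]) ?big_ord0 // => t; rewrite [t]tuple0; apply/esym/eqP.
rewrite big_ltn ?addnS ?ltnS ?leq_addr // mxE [RHS]big_mkcond big_tupleS.
apply: eq_bigr => b _; rewrite -addSn IHm /= [in LHS]big_mkcond mulr_sumr.
apply: eq_bigr => t _; case: ifP => _; last by rewrite mulr0.
rewrite big_ord_recl /= addn0; congr (_ * _); apply: eq_bigr => k _.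
rewrite /bump /= add1n addnS -addSn.
(* The two sides read the path with defaults [b] and [i]; every position is in range, so they
   agree. *)
congr (M _ _ _); apply: set_nth_default; last by rewrite size_tuple.
by rewrite /= size_tuple ltnS ltnW.
Qed.

(** The path starts at [i] and visits the entries of [t]; the factor [B] closes it from its end back
    to [i]. The start stays a separate summation index, to be eliminated later by the twist. *)
Lemma mxtrace_big_mulmx m (M : nat -> 'M[K]_n) (B : 'M[K]_n) :
  \tr ((\big[mulmx/1%:M]_(1 <= k < m.+1) M k) *m B) =
  \sum_(t : m.-tuple 'I_n) \sum_(i < n)
    (\prod_(k < m) M k.+1 (nth i (i :: t) k) (nth i t k)) * B (last i t) i.
Proof.
rewrite exchange_big; apply: eq_bigr => i _; rewrite mxE.
transitivity (\sum_j \sum_(t : m.-tuple 'I_n | last i t == j)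
    (\prod_(k < m) M k.+1 (nth i (i :: t) k) (nth i t k)) * B (last i t) i).
  apply: eq_bigr => j _; rewrite -[m.+1]add1n big_mulmxE mulr_suml.
  by apply: eq_bigr => t /eqP ->.
by rewrite [RHS](partition_big (fun t : m.-tuple 'I_n => last i t) predT).
Qed.

End MatrixProducts.

(** * The complex exponential and periodicity of powers of q *)

Section Exponentials.
Variable R : realType.
Local Notation C := R[i].

Lemma expCD (x y : C) : expC (x + y) = expC x * expC y.
Proof.
case: x y => [a b] [c d]; rewrite /expC /= expRD cosD sinD.
by apply/eqP; rewrite eq_complex /=; apply/andP; split; apply/eqP; ring.
Qed.

Lemma expC0 : expC (0 : C) = 1.
Proof.
rewrite /expC /= expR0 cos0 sin0; apply/eqP.
by rewrite eq_complex /=; apply/andP; split; apply/eqP; ring.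
Qed.

Lemma expC_nat (m : nat) : expC (two_pi_i R * m%:R) = 1.
Proof.
elim: m => [|m IHm]; first by rewrite mulr0 expC0.
rewrite -natr1 mulrDr expCD IHm mul1r mulr1 /expC /= expR0 mulrC.
have -> : 2 * pi = pi *+ 2 :> R by rewrite mulr_natl.
rewrite cos2pi sin2pi; apply/eqP.
by rewrite eq_complex /=; apply/andP; split; apply/eqP; ring.
Qed.

Lemma expC_int (m : int) : expC (two_pi_i R * m%:~R) = 1.
Proof.
case: m => m; first exact: expC_nat.
rewrite NegzE mulrNz mulrN.
have := expCD (two_pi_i R * m.+1%:R) (- (two_pi_i R * m.+1%:R)).
by rewrite subrr expC0 expC_nat mul1r => <-.
Qed.

Lemma qpowD n (x y : C) : qpow n (x + y) = qpow n x * qpow n y.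
Proof. by rewrite /qpow mulrDr mulrDl expCD. Qed.

Lemma qpow_sum n (I : Type) (r : seq I) (F : I -> C) :
  qpow n (\sum_(i <- r) F i) = \prod_(i <- r) qpow n (F i).
Proof.
by apply: (big_morph _ (@qpowD n)); rewrite /qpow mulr0 mul0r expC0.
Qed.

Lemma qpow_period n (x y : C) (m : int) : (0 < n)%N ->
  x = y + n%:R * m%:~R -> qpow n x = qpow n y.
Proof.
move=> n_gt0 ->; have n_neq0 : n%:R != 0 :> C by rewrite pnatr_eq0 -lt0n.
rewrite qpowD; suff -> : qpow n (n%:R * m%:~R) = 1 :> C by rewrite mulr1.
by rewrite /qpow [n%:R * _]mulrC mulrA mulfK // expC_int.
Qed.

End Exponentials.

(** * Entries of the intertwiners and their exponents modulo n *)

(** Each row of the twist is supported on a single column. The quotient [m] is recorded because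
    quadratic exponents with halves require the explicit multiple of [n]. *)
Lemma Twist_column (n : nat) (l : int) (i : 'I_n) :
  exists (j : 'I_n) (m : int),
    (forall j' : 'I_n, (i.+1%:Z == j'.+1%:Z + l %[mod n])%Z = (j' == j))
    /\ j.+1%:Z = i.+1%:Z - l + n%:Z * m.
Proof.
have n_gt0 : (0 < n)%N by case: n i => [[]|].
have n_neq0 : n%:Z != 0 by rewrite eqz_nat -lt0n.
(* Passing to 1-based indices shifts both sides by one, so the residue can be computed from the
   0-based [i]. *)
pose r := ((i%:Z - l) %% n)%Z.
have r_ge0 : 0 <= r by apply: modz_ge0.
have r_lt : (`|r| < n)%N by rewrite -ltz_nat gez0_abs // ltz_pmod.
have rE : (Ordinal r_lt)%:Z = i%:Z - l - ((i%:Z - l) %/ n)%Z * n%:Z.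
  by rewrite /= gez0_abs // /r modzE.
have jE : (Ordinal r_lt).+1%:Z = i.+1%:Z - l + n%:Z * - ((i%:Z - l) %/ n)%Z.
  by move: rE; set c := (_ %/ _)%Z; lia.
exists (Ordinal r_lt), (- ((i%:Z - l) %/ n)%Z); split=> // j'.
rewrite eqz_mod_dvd; apply/idP/eqP => [|->].
  case/dvdzP => c cE; apply: val_inj.
  have /eqP : (j' %% n)%Z = ((i%:Z - l) %% n)%Z.
    have -> : i%:Z - l = c * n%:Z + j'%:Z by move: cE; lia.
    by rewrite modzMDl.
  by rewrite modz_nat modn_small // -/r => /eqP /= <-.
by rewrite jE; apply/dvdzP; exists ((i%:Z - l) %/ n)%Z; ring.
Qed.

(** Collects all powers of q in one exponent, on which telescoping and reduction modulo [n] take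
    place. *)
Lemma Lambda_prod (R : realType) (n m : nat) (e : nat -> int)
    (u uh v vh d dh : nat -> R[i]) (i j : nat -> 'I_n) :
  \prod_(k < m) Lambda n (e k.+1) (u k.+1) (uh k.+1) (v k.+1) (vh k.+1)
                  (d k.+1) (dh k.+1) (i k) (j k)
  = qpow n (\sum_(k < m)
       (2 * (j k).+1%:R ^+ 2 + (i k).+1%:R - (j k).+1%:R
        + (e k.+1)%:~R * ((i k).+1%:R ^+ 2 + (j k).+1%:R ^+ 2
                          - 4 * (i k).+1%:R * (j k).+1%:R)) / 2)
    / (sqrtC n%:R ^+ m * \prod_(1 <= k < m.+1) (d k * dh k))
    * \prod_(k < m) (QDL n (u k.+1) (v k.+1) (j k).+1
                     * QDL n (uh k.+1) (vh k.+1) (j k).+1).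
Proof.
rewrite qpow_sum big_add1 big_mkord -[m in _ ^+ m]card_ord -prodr_const -big_split /=.
rewrite -prodf_div -big_split; apply: eq_bigr => k _ /=.
by rewrite mxE /= -[sqrtC _ * _ * _]mulrA; ring.
Qed.

Lemma twist_shiftE (n : nat) (l : int) : odd n ->
  exists c : int, 2 * twist_shift n l = l + n%:Z * c.
Proof.
move=> n_odd; pose p := n./2.
have -> : n = p.*2.+1 by rewrite -[LHS]odd_double_half n_odd.
(* For n = 2p + 1 one has (n-1)^2 = 4p^2 = 1 + n(2p - 1). *)
exists (l * (p.*2%:Z - 1)); rewrite /twist_shift /=.
have -> : (p.*2 ^ 2 %/ 2 = p * p.*2)%N by rewrite expnS expn1 -{1}mul2n -mulnA mulKn.
by rewrite -mul2n; lia.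
Qed.

(* The row index z0 of Lambda_1 is replaced by zL - l1 modulo n; this is the
   only place where eps_1 = -1 is used. *)
Lemma twisted_exponent (R : realType) (n : nat) (z0 z1 zL l1 l2 lh1 lh2 m : int) :
  odd n -> z0 = zL - l1 + n%:Z * m ->
  l1 = twist_shift n lh1 -> l2 = twist_shift n lh2 ->
  exists c : int,
  (2 * z1%:~R ^+ 2 + z0%:~R - z1%:~R
     - (z0%:~R ^+ 2 + z1%:~R ^+ 2 - 4 * z0%:~R * z1%:~R)) / 2
    + (z1%:~R - zL%:~R) / 2
    + (- (2 * z0%:~R * l2%:~R) - z0%:~R * l1%:~R)
  = 2 * l1%:~R * l2%:~R - l1%:~R / 2 + l1%:~R ^+ 2 / 2
    + (- zL%:~R * lh2%:~R - z1%:~R * lh1%:~R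
       + (z1%:~R ^+ 2 - (zL%:~R ^+ 2 + z1%:~R ^+ 2 - 4 * zL%:~R * z1%:~R) / 2))
    + n%:R * c%:~R :> R[i].
Proof.
move=> n_odd -> /(congr1 ( *%R 2)) l1E /(congr1 ( *%R 2)) l2E.
have [c1 c1E] := twist_shiftE lh1 n_odd; have [c2 c2E] := twist_shiftE lh2 n_odd.
rewrite {}c1E in l1E; rewrite {}c2E in l2E.
(* The pure [m] terms nm/2 - (nm)^2/2 equal -n(m(m-1)/2 + pm^2) for n = 2p + 1, an integer multiple
   of n. *)
have [b bE] : exists b : int, m * (m - 1) = 2 * b.
  have [a [->|->]] : exists a : int, m = 2 * a \/ m = 2 * a + 1.
  - by exists (m %/ 2)%Z; lia.
  - by exists (a * (2 * a - 1)); ring.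
  - by exists ((2 * a + 1) * a); ring.
pose p : int := n./2.
have nE : n%:Z = 2 * p + 1.
  by rewrite -{1}[n]odd_double_half n_odd /p; lia.
have {}l1E : lh1 = 2 * l1 - n%:Z * c1 by rewrite l1E; ring.
have {}l2E : lh2 = 2 * l2 - n%:Z * c2 by rewrite l2E; ring.
(* After the pure [m] terms come the cross terms of nm with zL - l1, with z1 and with the twist
   exponent; the last two terms come from replacing lh by 2l. *)
exists (- b - p * m ^+ 2 - (zL - l1) * m + 2 * m * z1 - m * (2 * l2 + l1)
        - zL * c2 - z1 * c1).
have -> : n%:R = n%:Z%:~R :> R[i] by [].
rewrite l1E l2E nE.
have two_neq0 : 2 != 0 :> R[i] by rewrite pnatr_eq0.
have bE' : (b%:~R : R[i]) = m%:~R * (m%:~R - 1) / 2.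
  by rewrite -[m%:~R - 1](rmorphB _ m 1) -rmorphM bE rmorphM /= mulrC mulKf.
by rewrite !(rmorphB, rmorphD, rmorphN, rmorphM, rmorphXn) /= bE'; field.
Qed.

(* The exponent of q in the prefactor is lhat1 * lhat2 / 2 - lhat1 / 4 with
   lhat_j / 2 taken modulo n, that is as l_j, together with the term l1^2 / 2,
   which the closed formula needs unless it vanishes modulo n. *)
Theorem proposition3p8 (R : realType) (n : nat) (n_odd : odd n)
    (phi : pA_word) (h : R[i]) (s : nat -> edge_weights R)
    (u uh v vh : nat -> R[i])
    (data : periodic_flips n (letters phi) h s u uh v vh)
    (d dh : nat -> R[i])
    (dE : forall k, (1 <= k <= size (letters phi))%N ->
       d k ^+ n = Dq n (u k) (v k) /\ dh k ^+ n = Dq n (uh k) (vh k))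
    (A B : nat -> R[i])
    (AB_log : forall k, (k <= size (letters phi))%N ->
       wx (s k) = expC (A k / n%:R) /\ wy (s k) = expC (B k / n%:R))
    (lhat1 lhat2 : int)
    (lhat1E : A 0%N = A (size (letters phi)) + two_pi_i R * lhat1%:~R)
    (lhat2E : B 0%N = B (size (letters phi)) + two_pi_i R * lhat2%:~R) :
  let w := letters phi in
  let k0 := size w in
  let eps k : R[i] := (letter_sign (cnth letL w k))%:~R in
  let l1 := twist_shift n lhat1 in
  let l2 := twist_shift n lhat2 in
  let A_n : R[i] :=
    qpow n (2 * l1%:~R * l2%:~R - l1%:~R / 2 + l1%:~R ^+ 2 / 2)
    / (sqrtC n%:R ^+ k0 * \prod_(1 <= k < k0.+1) (d k * dh k)) in
  \tr ((\big[mulmx/1%:M]_(1 <= k < k0.+1)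
          Lambda n (letter_sign (cnth letL w k))
            (u k) (uh k) (v k) (vh k) (d k) (dh k))
       *m Twist R n l1 l2)
  = A_n *
    \sum_(t : k0.-tuple 'I_n)
      let i k := cnth 0%N [seq (val a).+1 | a <- t] k in
      let z k : R[i] := (i k)%:R in
      expC (two_pi_i R / n%:R *
        (- z k0 * lhat2%:~R - z 1%N * lhat1%:~R
         + \sum_(1 <= k < k0.+1)
             (z k.+1 ^+ 2
              + eps k.+1 / 2
                * (z k ^+ 2 + z k.+1 ^+ 2 - 4 * z k * z k.+1))))
      * \prod_(1 <= k < k0.+1)
          (QDL n (u k) (v k) (i k) * QDL n (uh k) (vh k) (i k)).
Proof.
move=> w k0 eps l1 l2 A_n.
(* The first block starts with a positive power of L. *)
have [w_gt0 w0] : (0 < k0)%N /\ nth letL w 0 = letL.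
  rewrite /k0 /w /letters.
  by case: (blocks phi) (blocks_neq0 phi) (blocks_gt0 phi) => //= -[[|a] b] s'.
have c1 : cnth letL w 1 = letL by rewrite cnth_nth.
have cL : cnth letL w k0.+1 = letL by rewrite cnth_size.
rewrite {}/A_n {}/eps.
have [m mE] : exists m, k0 = m.+1 by exists k0.-1; rewrite prednK.
rewrite -/k0 mE in cL *.
(* The letters are now an arbitrary sequence [c], with L at position 1 and at its cyclic return
   [m.+2]. *)
move: (cnth letL w) c1 cL => c c1 cL.
(* The sums are compared path by path: [t] is (i_1, ..., i_{k0}), and i_0 remains as an inner
   sum. *)
rewrite mxtrace_big_mulmx mulr_sumr; apply: eq_bigr => t _.
pose i := cnth 0%N [seq (nat_of_ord a).+1 | a <- t]; rewrite /= -/i.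
have iE j k : (k < m.+1)%N -> i k.+1 = (nth j t k).+1.
  by move=> lt_k; rewrite /i cnth_nth ?size_map ?size_tuple // (nth_map j) ?size_tuple.
have iL : i m.+2 = i 1%N.
  have -> : m.+2 = (size [seq (nat_of_ord a).+1 | a <- t]).+1 by rewrite size_map size_tuple.
  by rewrite /i cnth_size [in RHS]cnth_nth ?size_map ?size_tuple.
have lastE j : last j t = nth j t m by rewrite -nth_last size_tuple.
(* The twist leaves [j] as the only value of i_0. *)
have [j [q [jP jE]]] := Twist_column l1 (nth (thead t) t m).
have last_j j' : last j' t = nth (thead t) t m.
  by rewrite lastE; apply: set_nth_default; rewrite size_tuple.
rewrite (bigD1 j) //= [X in _ + X]big1 ?addr0; last first.
  by move=> j' /negPf nj; rewrite mxE last_j jP nj mulr0.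
rewrite mxE last_j jP eqxx.
rewrite (Lambda_prod _ (fun k => letter_sign (c k)) _ _ _ _ _ _
           (fun k => nth j (j :: t) k) (fun k => nth j t k)).
set Q := \prod_(k < _) (QDL _ _ _ _ * _).
have -> : \prod_(1 <= k < m.+2)
    (QDL n (u k) (v k) (i k) * QDL n (uh k) (vh k) (i k)) = Q.
  by rewrite big_add1 big_mkord; apply: eq_bigr => k _; rewrite -(iE j).
(* Indices drop by one here: [z k] is i_{k+1} and [e k] is the sign of the letter k+1. *)
pose z k : R[i] := (i k.+1)%:R.
pose e k : R[i] := (letter_sign (c k.+1))%:~R.
set E1 := \sum_(k < _) _.
(* The first factor, with sign -1, is split off. In the others the parts (I - J)/2 telescope,
   leaving summands of the closed formula. *)
have {E1} -> : E1 =
    (2 * z 0%N ^+ 2 + j.+1%:R - z 0%N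
     - (j.+1%:R ^+ 2 + z 0%N ^+ 2 - 4 * j.+1%:R * z 0%N)) / 2
    + ((z 0%N - z m) / 2
    + \sum_(k < m) (z k.+1 ^+ 2
        + e k.+1 / 2 * (z k ^+ 2 + z k.+1 ^+ 2 - 4 * z k * z k.+1))).
  rewrite {}/E1 big_ord_recl /=; congr (_ + _).
    by rewrite c1 -(iE j) // /z; congr (_ / 2); rewrite /=; ring.
  rewrite -[z 0%N - z m]opprB -(telescope_sumr z (leq0n m)) big_mkord mulNr mulr_suml -sumrN -big_split.
  apply: eq_bigr => k _ /=; rewrite /bump /= add1n.
  have lt_k := ltn_ord k.
  rewrite -!(iE j) ?ltnS // 1?ltnW // -/(z k) -/(z k.+1) -/(e k.+1).
  by field.
set E2 := (X in expC (_ * (_ + X))).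
(* The last summand wraps around to i_1 with sign -1; the others form the same sum as in [E1]. *)
have {E2} -> : E2 =
    (z 0%N ^+ 2 - (z m ^+ 2 + z 0%N ^+ 2 - 4 * z m * z 0%N) / 2)
    + \sum_(k < m) (z k.+1 ^+ 2
        + e k.+1 / 2 * (z k ^+ 2 + z k.+1 ^+ 2 - 4 * z k * z k.+1)).
  rewrite {}/E2 big_add1 big_mkord big_ord_recr /= addrC; congr (_ + _).
  by rewrite iL cL /z /=; field.
set S := \sum_(k < m) _.
have zmE : z m = (nth (thead t) t m).+1%:R by rewrite /z (iE (thead t)).
have [a aE] := twisted_exponent R (i 1%N) n_odd jE (erefl l1) (erefl l2).
rewrite -!pmulrn -zmE -/(z 0%N) in aE.
have -> (x : R[i]) : expC (two_pi_i R / n%:R * x) = qpow n x by rewrite /qpow mulrAC.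
(* The normalisations and dilogarithm products agree, so only the exponents of q remain to be
   compared modulo [n]. *)
have swap (x y x' y' P Q' : R[i]) :
    x * y = x' * y' -> x / P * Q' * y = x' / P * (y' * Q').
  by move=> xyE; transitivity (x * y * (P^-1 * Q')); [ring | rewrite xyE; ring].
apply: swap; rewrite -!qpowD; apply: (qpow_period (m := a) (odd_gt0 n_odd)).
rewrite -/(z m) -/(z 0%N).
transitivity (S + ((2 * z 0%N ^+ 2 + j.+1%:R - z 0%N -
      (j.+1%:R ^+ 2 + z 0%N ^+ 2 - 4 * j.+1%:R * z 0%N)) / 2 + (z 0%N - z m) / 2
      + (- (2 * j.+1%:R * l2%:~R) - j.+1%:R * l1%:~R))); first by ring.
by rewrite aE /=; ring.
Qed.
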